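(* Let $0\le s<1/2$ and let $u_0\in H^{-s}(\mathbf{T})$ have mean zero. Let $\mathcal{S}$ be the phase-shift operator defined by $$\mathcal{F}_x[\mathcal{S}v](t,\xi)=\exp\Big(-2i\frac{|\widehat{u_0}(\xi)|^2}{\xi}t\Big)\widehat v(t,\xi).$$ Then for any $t,\alpha\in\mathbf{R}$, if $v(t)\in H^\alpha(\mathbf{T})$, $$\|\mathcal{S}[v](t)-v(t)\|_{H^{\alpha+1-2s}_x}\lesssim|t|\,\|u_0\|_{H^{-s}}^2\,\|v(t)\|_{H^\alpha},$$ with an absolute implicit constant.
   Context: $\mathbf{T}=\mathbf{R}/2\pi\mathbf{Z}$, $\langle\xi\rangle=1+|\xi|$, $\widehat f(\xi)=\int_{\mathbf{T}}f(x)e^{-ix\xi}dx$ for $\xi\in\mathbf{Z}$, and $\|f\|_{H^\sigma}=\|\langle\xi\rangle^\sigma\widehat f(\xi)\|_{\ell^2_\xi}$. At $\xi=0$ the exponential factor in $\mathcal{S}$ is taken to be $1$ (recall $\widehat{u_0}(0)=0$). *)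

(* Defs.v *)
From HB Require Import structures.
From mathcomp Require Import all_boot all_order all_algebra.
From mathcomp Require Import complex.
From mathcomp Require Import all_classical all_reals all_analysis.
From mathcomp Require Import ring lra.

Set Implicit Arguments.
Unset Strict Implicit.
Unset Printing Implicit Defensive.

Import Order.TTheory GRing.Theory Num.Theory.
Import numFieldNormedType.Exports.
Import Normc.

Local Open Scope classical_set_scope.
Local Open Scope ring_scope.
Local Open Scope complex_scope.

Section Torus.
Context {R : realType}.
Local Notation C := R[i].

Definition smooth (f : R -> R) : Prop :=
  forall n x, derivable (derive1n n f) x 1.

(* A function on the torus is a 2pi-periodic function on R.  Since R[i] carries
   no normed R-module structure, derivatives are taken on real and imaginary
   parts. *)
Definition test_function (phi : R -> C) : Prop :=
  [/\ periodic phi (pi *+ 2),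
      smooth (fun x => complex.Re (phi x)) &
      smooth (fun x => complex.Im (phi x))].

Definition cderive (n : nat) (phi : R -> C) (x : R) : C :=
  derive1n n (fun y => complex.Re (phi y)) x +i*
  derive1n n (fun y => complex.Im (phi y)) x.

(* Distributions on the torus: linear functionals on the periodic smooth
   functions, continuous for the seminorms max_(k <= N) sup |phi^(k)|.  Values
   outside test functions are irrelevant.  The pairing is bilinear, so that an
   integrable function f acts by phi |-> \int_0^(2pi) f phi. *)
Record tdistribution := TDistribution {
  pairing :> (R -> C) -> C;
  pairing_linear : forall (a : C) phi psi,
    test_function phi -> test_function psi ->
    pairing (fun x => a * phi x + psi x) = a * pairing phi + pairing psi;
  pairing_continuous : exists (B : R) (N : nat), forall phi (M : R),
    test_function phi ->
    (forall k x, (k <= N)%N -> normc (cderive k phi x) <= M) ->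
    normc (pairing phi) <= B * M }.

Definition expi (theta : R) : C := cos theta +i* sin theta.

(* u tested against e^{- i x xi}, with no factor 1 / (2 pi) *)
Definition fourier (u : tdistribution) (xi : int) : C :=
  u (fun x => expi (- (x * xi%:~R))).

Definition bracket (xi : int) : R := 1 + `|xi%:~R|.

(* valued in the extended reals: +oo when u is not in H^sigma *)
Definition sobolev_norm (sigma : R) (u : tdistribution) : \bar R :=
  ((\esum_(xi in [set: int])
    ((bracket xi `^ sigma * normc (fourier u xi))%R ^+ 2)%:E) `^ 2^-1)%E.

Definition in_sobolev (sigma : R) (u : tdistribution) : Prop :=
  (sobolev_norm sigma u < +oo)%E.

(* exp (- 2 i |hat u0 (xi)|^2 t / xi), read as 1 at xi = 0 *)
Definition phase_factor (u0 : tdistribution) (t : R) (xi : int) : C :=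
  if xi == 0 then 1
  else expi (- 2 * (normc (fourier u0 xi) ^+ 2 / xi%:~R) * t).

Lemma tdist_sub_linear (u w : tdistribution) (a : C) phi psi :
  test_function phi -> test_function psi ->
  u (fun x => a * phi x + psi x) - w (fun x => a * phi x + psi x) =
  a * (u phi - w phi) + (u psi - w psi).
Proof. by move=> t1 t2; rewrite !pairing_linear //; ring. Qed.

Lemma tdist_sub_continuous (u w : tdistribution) :
  exists (B : R) (N : nat), forall phi (M : R),
    test_function phi ->
    (forall k x, (k <= N)%N -> normc (cderive k phi x) <= M) ->
    normc (u phi - w phi) <= B * M.
Proof.
have [B1 [N1 H1]] := pairing_continuous u.
have [B2 [N2 H2]] := pairing_continuous w.
exists (B1 + B2), (maxn N1 N2) => phi M tphi H.
apply: (le_trans (le_normcD _ _)); rewrite normcN mulrDl; apply: lerD.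
- by apply: H1 => // k x kN; apply: H; rewrite leq_max kN.
- by apply: H2 => // k x kN; apply: H; rewrite leq_max kN orbT.
Qed.

Definition tdist_sub (u w : tdistribution) : tdistribution :=
  TDistribution (tdist_sub_linear u w) (tdist_sub_continuous u w).

End Torus.

Arguments tdistribution R : clear implicits.

(* Bounded Fourier multipliers act on distributions: the image of u is
   phi |-> (2 pi)^-1 \sum_k m_k hat u (k) (- i k)^-K \int phi^(K) e^{ikx} for K
   large with respect to the order of u (and K = 0 in the mode k = 0). *)
Section Multipliers.
Context {R : realType}.
Local Notation C := R[i].
Local Notation mu := (@lebesgue_measure R).
Local Notation I := ([set` `[0, (@pi R *+ 2)]]).

Lemma smooth_continuous (f : R -> R) n : smooth f -> continuous (derive1n n f).
Proof.
move=> sf x; apply/differentiable_continuous/derivable1_diffP; exact: sf.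
Qed.

Lemma derive1n_lin (a b : R) (f g h : R -> R) n : smooth f -> smooth g -> smooth h ->
  derive1n n (fun x => a * f x + b * g x + h x) =
  (fun x => a * derive1n n f x + b * derive1n n g x + derive1n n h x).
Proof.
move=> sf sg sh; elim: n => [//|n IH].
rewrite !derive1nS IH; apply/funext => x; rewrite !derive1E.
have df := derivableP (sf n x); have dg := derivableP (sg n x).
have dh := derivableP (sh n x).
pose F := a \*: derive1n n f; pose G := b \*: derive1n n g.
have dF : is_derive x 1 F (a *: 'D_1 (derive1n n f) x) by exact: is_deriveZ.
have dG : is_derive x 1 G (b *: 'D_1 (derive1n n g) x) by exact: is_deriveZ.
have dFG := is_deriveD dF dG.
have dFGH := is_deriveD dFG dh.
by rewrite (@derive_val _ _ _ _ _ _ _ dFGH).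
Qed.

Lemma cderive_lin (a : C) (phi psi : R -> C) n x : test_function phi -> test_function psi ->
  cderive n (fun y => a * phi y + psi y) x =
  a * cderive n phi x + cderive n psi x.
Proof.
case=> _ r1 i1 [_ r2 i2]; rewrite /cderive.
have -> : (fun y => complex.Re (a * phi y + psi y)) =
  (fun y => complex.Re a * complex.Re (phi y) + (- complex.Im a) * complex.Im (phi y) + complex.Re (psi y)).
  by apply/funext => y; case: a (phi y) (psi y) => [? ?] [? ?] [? ?] /=; ring.
have -> : (fun y => complex.Im (a * phi y + psi y)) =
  (fun y => complex.Im a * complex.Re (phi y) + complex.Re a * complex.Im (phi y) + complex.Im (psi y)).
  by apply/funext => y; case: a (phi y) (psi y) => [? ?] [? ?] [? ?] /=; ring.
rewrite (derive1n_lin _ _ _ r1 i1 r2) (derive1n_lin _ _ _ r1 i1 i2).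
by case: a => a1 a2; apply/eqP; rewrite eq_complex /=; apply/andP; split; apply/eqP; ring.
Qed.

Lemma cderive_continuous (phi : R -> C) n : test_function phi ->
  continuous (fun x => complex.Re (cderive n phi x)) /\
  continuous (fun x => complex.Im (cderive n phi x)).
Proof. by case=> _ r i; split=> /=; exact: smooth_continuous. Qed.

Lemma is_derive_expi (a b k x : R) :
  is_derive x 1 (fun y : R => a * cos (y * k) + b * sin (y * k))
    (k * (b * cos (x * k) - a * sin (x * k))).
Proof.
have dk : is_derive x 1 (fun y : R => y * k) k.
  have -> : (fun y : R => y * k) = k \*: id.
    by apply/funext => y /=; rewrite mulrC.
  by apply: is_derive_eq; rewrite /GRing.scale/= mulr1.
have dc := is_deriveZ a (@is_derive1_comp _ cos (fun y => y * k) x _ _ (is_derive_cos (x * k)) dk).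
have ds := is_deriveZ b (@is_derive1_comp _ sin (fun y => y * k) x _ _ (is_derive_sin (x * k)) dk).
have dd := is_deriveD dc ds.
set l := (X in is_derive _ _ _ X).
have -> : l = a *: (- sin (x * k) * k) + b *: (cos (x * k) * k).
  by rewrite /l /GRing.scale/=; ring.
exact: dd.
Qed.

Lemma derive1n_trig (a b k : R) n :
  exists a' b', derive1n n (fun y : R => a * cos (y * k) + b * sin (y * k)) =
     (fun y : R => a' * cos (y * k) + b' * sin (y * k)) /\
     a' +i* b' = (- ('i * k%:C)) ^+ n * (a +i* b).
Proof.
elim: n => [|n [a' [b' [E1 E2]]]]; first by exists a, b; rewrite expr0 mul1r.
exists (k * b'), (- (k * a')); split.
  rewrite derive1nS E1; apply/funext => x; rewrite derive1E.
  rewrite (@derive_val _ _ _ _ _ _ _ (is_derive_expi a' b' k x)); ring.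
rewrite exprS -mulrA -E2.
by apply/eqP; rewrite eq_complex /=; apply/andP; split; apply/eqP; ring.
Qed.

Lemma smooth_trig (a b k : R) :
  smooth (fun y : R => a * cos (y * k) + b * sin (y * k)).
Proof.
move=> n x; have [a' [b' [-> _]]] := derive1n_trig a b k n.
by case: (is_derive_expi a' b' k x).
Qed.

Lemma Re_expi (k : R) : (fun y : R => complex.Re (expi (y * k))) =
  (fun y : R => 1 * cos (y * k) + 0 * sin (y * k)).
Proof. by apply/funext => y /=; rewrite mul1r mul0r addr0. Qed.

Lemma Im_expi (k : R) : (fun y : R => complex.Im (expi (y * k))) =
  (fun y : R => 0 * cos (y * k) + 1 * sin (y * k)).
Proof. by apply/funext => y /=; rewrite mul1r mul0r add0r. Qed.

Lemma cderive_expi n (k x : R) : 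
  cderive n (fun y => expi (y * k)) x = ('i * k%:C) ^+ n * expi (x * k).
Proof.
rewrite /cderive Re_expi Im_expi.
have [a [b [-> E]]] := derive1n_trig 1 0 k n.
have [a' [b' [-> E']]] := derive1n_trig 0 1 k n.
have H : ('i * k%:C) ^+ n = a -i* b :> C.
  have -> : 'i * k%:C = (- ('i * k%:C))^* :> C.
    by apply/eqP; rewrite eq_complex /=; apply/andP; split; apply/eqP; ring.
  have E0 : (- ('i * k%:C)) ^+ n = a +i* b :> C.
    by rewrite E -[1 +i* 0]/(1 : C) mulr1.
  by rewrite -[_ -i* _]/((a +i* b)^*) -E0 rmorphXn.
have [Ea Eb] : a' = - b /\ b' = a.
  move: E'; have -> : 0 +i* 1 = 'i * (1 +i* 0) :> C.
    by apply/eqP; rewrite eq_complex /=; apply/andP; split; apply/eqP; ring.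
  rewrite mulrCA -E => /eqP; rewrite eq_complex /= => /andP[/eqP-> /eqP->].
  by split; ring.
rewrite H Ea Eb /expi.
by apply/eqP; rewrite eq_complex /=; apply/andP; split; apply/eqP; ring.
Qed.

Lemma expiD (x y : R) : expi (x + y) = expi x * expi y.
Proof.
rewrite /expi cosD sinD.
by apply/eqP; rewrite eq_complex /=; apply/andP; split; apply/eqP; ring.
Qed.

Lemma normc_expi (x : R) : normc (expi x) = 1.
Proof. by rewrite /normc /expi cos2Dsin2 sqrtr1. Qed.

Lemma expi2pi (k : int) : expi ((@pi R *+ 2) * k%:~R) = 1.
Proof.
have P (n : nat) : expi ((@pi R *+ 2) * n%:R) = 1.
  rewrite /expi mulr_natr -[_ *+ n]add0r.
  by rewrite (periodicn (@cosD2pi R)) (periodicn (@sinD2pi R)) cos0 sin0.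
case: k => n; first exact: P.
rewrite NegzE mulrNz mulrN -pmulrn; have := P n.+1.
rewrite /expi cosN sinN => /eqP; rewrite eq_complex /= => /andP[/eqP-> /eqP->].
by rewrite oppr0.
Qed.

Lemma test_expi (k : int) : test_function (fun x : R => expi (x * k%:~R)).
Proof.
split.
- by move=> x; rewrite mulrDl expiD expi2pi mulr1.
- by rewrite Re_expi; exact: smooth_trig.
- by rewrite Im_expi; exact: smooth_trig.
Qed.

Local Notation T := (@pi R *+ 2).

Local Lemma mI : measurable (I : set (measurableTypeR R)).
Proof. exact: measurable_itv. Qed.

Local Lemma muI : mu I = (pi *+ 2)%:E.
Proof.
rewrite lebesgue_measure_itv /= lte_fin pmulrn_lgt0 // pi_gt0.
by rewrite -EFinB subr0.
Qed.

Local Lemma Rint_cst (M : R) : \int[mu]_(x in I) M = M * (pi *+ 2).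
Proof.
rewrite (@Rintegral_cst _ _ _ mu _ mI); congr (_ * _).
exact: (congr1 fine muI).
Qed.

Lemma integrable_cont (f : R -> R) : continuous f -> mu.-integrable I (EFin \o f).
Proof.
move=> cf; apply: continuous_compact_integrable; first exact: segment_compact.
by apply: continuous_subspaceT.
Qed.

Lemma cont_lin (a b : R) (f g : R -> R) : continuous f -> continuous g ->
  continuous (fun x => a * f x + b * g x).
Proof.
move=> cf cg x; apply: cvgD; apply: cvgM; [exact: cvg_cst|exact: cf|
  exact: cvg_cst|exact: cg].
Qed.

Lemma Rint_lin (a b : R) (f g h : R -> R) :
  continuous f -> continuous g -> continuous h ->
  \int[mu]_(x in I) (a * f x + b * g x + h x) =
  a * \int[mu]_(x in I) f x + b * \int[mu]_(x in I) g x + \int[mu]_(x in I) h x.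
Proof.
move=> cf cg ch.
have If := integrable_cont cf; have Ig := integrable_cont cg.
have Ih := integrable_cont ch.
have Iaf : mu.-integrable I (EFin \o (fun x => a * f x)).
  by apply: integrable_cont => x; apply: cvgM; [exact: cvg_cst|exact: cf].
have Ibg : mu.-integrable I (EFin \o (fun x => b * g x)).
  by apply: integrable_cont => x; apply: cvgM; [exact: cvg_cst|exact: cg].
have Iab : mu.-integrable I (EFin \o (fun x => a * f x + b * g x)).
  by apply: integrable_cont; exact: cont_lin.
rewrite (@RintegralD _ _ _ mu _ (fun x => a * f x + b * g x) h mI Iab Ih).
rewrite (@RintegralD _ _ _ mu _ (fun x => a * f x) (fun x => b * g x) mI Iaf Ibg).
by rewrite (@RintegralZl _ _ _ mu _ f a mI If) (@RintegralZl _ _ _ mu _ g b mI Ig).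
Qed.

Lemma Rint_bound (f : R -> R) (M : R) : continuous f ->
  (forall x, `|f x| <= M) -> `|\int[mu]_(x in I) f x| <= M * (pi *+ 2).
Proof.
move=> cf fM.
have := @le_normr_Rintegral _ _ _ mu _ f mI (integrable_cont cf).
move=> /le_trans; apply.
have -> : M * (pi *+ 2) = \int[mu]_(x in I) M.
  by rewrite Rint_cst.
apply: (@le_Rintegral _ _ _ mu _ (fun x => `|f x|) (fun=> M) mI) => //.
- apply: integrable_cont => x; apply: continuous_comp; [exact: cf|exact: norm_continuous].
- by apply: integrable_cont => x; exact: cvg_cst.
Qed.

Lemma cont_trig (a b k : R) : continuous (fun y : R => a * cos (y * k) + b * sin (y * k)).
Proof.
move=> x; apply/differentiable_continuous/derivable1_diffP.
by case: (is_derive_expi a b k x).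
Qed.

Lemma Rint_trig (a b : R) (k : int) :
  \int[mu]_(x in I) (a * cos (x * k%:~R) + b * sin (x * k%:~R)) =
  if k == 0 then a * (pi *+ 2) else 0.
Proof.
have p2 : 0 < pi *+ 2 :> R by rewrite pmulrn_lgt0 // pi_gt0.
have [->|k0] := eqVneq k 0.
  under eq_Rintegral do rewrite mulr0z mulr0 cos0 sin0 mulr0 addr0 mulr1.
  by rewrite Rint_cst.
have kn : k%:~R != 0 :> R by rewrite intr_eq0.
pose F : R -> R := fun x : R => (- (b / k%:~R)) * cos (x * k%:~R) + (a / k%:~R) * sin (x * k%:~R).
have dF (x : R) : is_derive x 1 F (a * cos (x * k%:~R) + b * sin (x * k%:~R)).
  have := is_derive_expi (- (b / k%:~R)) (a / k%:~R) k%:~R x.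
  suff -> : k%:~R * (a / k%:~R * cos (x * k%:~R) - - (b / k%:~R) * sin (x * k%:~R))
    = a * cos (x * k%:~R) + b * sin (x * k%:~R) by [].
  by field.
have cF : continuous F by exact: cont_trig.
rewrite /Rintegral (@continuous_FTC2 _ _ F) //.
- rewrite /F /= mul0r cos0 sin0.
  have /eqP := expi2pi k; rewrite eq_complex /= => /andP[/eqP-> /eqP->].
  ring.
- by apply: continuous_subspaceT; exact: cont_trig.
- split.
  + by move=> x _; case: (dF x).
  + by apply: cvg_at_right_filter; exact: cF.
  + by apply: cvg_at_left_filter; exact: cF.
- by move=> x _; rewrite derive1E; apply: derive_val.
Qed.

Definition cint (f : R -> C) : C :=
  (\int[mu]_(x in I) complex.Re (f x)) +i* (\int[mu]_(x in I) complex.Im (f x)).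

Definition ccont (f : R -> C) : Prop :=
  continuous (fun x => complex.Re (f x)) /\ continuous (fun x => complex.Im (f x)).

Lemma normc_le (z : C) : normc z <= `|complex.Re z| + `|complex.Im z|.
Proof.
case: z => a b /=; rewrite -(ler_pXn2r (n := 2)) // ?nnegrE ?sqrtr_ge0 ?addr_ge0 //.
rewrite sqr_sqrtr ?addr_ge0 ?sqr_ge0 // sqrrD !real_normK ?num_real //.
by rewrite -addrA lerD2l lerDr mulrn_wge0 // mulr_ge0.
Qed.

Lemma Re_le_normc (z : C) : `|complex.Re z| <= normc z.
Proof. by case: z => a b /=; rewrite -sqrtr_sqr ler_wsqrtr // lerDl sqr_ge0. Qed.

Lemma Im_le_normc (z : C) : `|complex.Im z| <= normc z.
Proof. by case: z => a b /=; rewrite -sqrtr_sqr ler_wsqrtr // lerDr sqr_ge0. Qed.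

Lemma cint_lin a f g : ccont f -> ccont g ->
  cint (fun x => a * f x + g x) = a * cint f + cint g.
Proof.
move=> [fr fi] [gr gi]; rewrite /cint.
have -> : (fun y => complex.Re (a * f y + g y)) =
  (fun y => complex.Re a * complex.Re (f y) + (- complex.Im a) * complex.Im (f y) + complex.Re (g y)).
  by apply/funext => y; case: a (f y) (g y) => [? ?] [? ?] [? ?] /=; ring.
have -> : (fun y => complex.Im (a * f y + g y)) =
  (fun y => complex.Im a * complex.Re (f y) + complex.Re a * complex.Im (f y) + complex.Im (g y)).
  by apply/funext => y; case: a (f y) (g y) => [? ?] [? ?] [? ?] /=; ring.
rewrite (Rint_lin _ _ fr fi gr) (Rint_lin _ _ fr fi gi).
by case: a => a1 a2; apply/eqP; rewrite eq_complex /=; apply/andP; split; apply/eqP; ring.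
Qed.

Lemma cint_bound f M : ccont f -> (forall x, normc (f x) <= M) ->
  normc (cint f) <= 2 * M * (pi *+ 2).
Proof.
move=> [fr fi] fM; apply: (le_trans (normc_le _)) => /=.
rewrite -mulrA mulr_natl mulr2n; apply: lerD; apply: Rint_bound => // x.
- exact: le_trans (Re_le_normc _) (fM x).
- exact: le_trans (Im_le_normc _) (fM x).
Qed.

Lemma cint_expi (c : C) (k : int) :
  cint (fun x => c * expi (x * k%:~R)) = if k == 0 then c * (pi *+ 2)%:C else 0.
Proof.
rewrite /cint.
have -> : (fun x : R => complex.Re (c * expi (x * k%:~R))) =
  (fun x => complex.Re c * cos (x * k%:~R) + (- complex.Im c) * sin (x * k%:~R)).
  by apply/funext => y; case: c => [? ?] /=; ring.
have -> : (fun x : R => complex.Im (c * expi (x * k%:~R))) =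
  (fun x => complex.Im c * cos (x * k%:~R) + complex.Re c * sin (x * k%:~R)).
  by apply/funext => y; case: c => [? ?] /=; ring.
rewrite !Rint_trig; case: eqP => // _.
by case: c => a1 a2; apply/eqP; rewrite eq_complex /=; apply/andP; split; apply/eqP; ring.
Qed.

Lemma ccont_mul_expi f k : ccont f -> ccont (fun x => f x * expi (x * k)).
Proof.
move=> [fr fi].
have cc : continuous (fun x : R => cos (x * k)).
  move=> x; have := @cont_trig 1 0 k x.
  by under eq_fun do rewrite mul1r mul0r addr0.
have cs : continuous (fun x : R => sin (x * k)).
  move=> x; have := @cont_trig 0 1 k x.
  by under eq_fun do rewrite mul1r mul0r add0r.
split=> x.
- rewrite (_ : (fun y => _) = (fun y => complex.Re (f y) * cos (y * k) - complex.Im (f y) * sin (y * k))).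
    by apply: cvgB; apply: cvgM; [exact: fr|exact: cc|exact: fi|exact: cs].
  by apply/funext => y; case: (f y).
- rewrite (_ : (fun y => _) = (fun y => complex.Re (f y) * sin (y * k) + complex.Im (f y) * cos (y * k))).
    by apply: cvgD; apply: cvgM; [exact: fr|exact: cs|exact: fi|exact: cc].
  by apply/funext => y; case: (f y).
Qed.

Definition fcoef n (k : int) (phi : R -> C) : C :=
  cint (fun x => cderive n phi x * expi (x * k%:~R)).

Lemma ccont_fcoef n (k : int) phi : test_function phi ->
  ccont (fun x => cderive n phi x * expi (x * k%:~R)).
Proof.
by move=> tphi; apply: ccont_mul_expi; exact: (cderive_continuous n tphi).
Qed.

Lemma fcoef_lin n k a phi psi : test_function phi -> test_function psi ->
  fcoef n k (fun x => a * phi x + psi x) = a * fcoef n k phi + fcoef n k psi.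
Proof.
move=> t1 t2; rewrite /fcoef -cint_lin; [|exact: ccont_fcoef..].
by congr cint; apply/funext => x; rewrite cderive_lin // mulrDl mulrA.
Qed.

Lemma fcoef_bound n k phi M : test_function phi ->
  (forall x, normc (cderive n phi x) <= M) ->
  normc (fcoef n k phi) <= 2 * M * (pi *+ 2).
Proof.
move=> tphi H; apply: cint_bound; first exact: ccont_fcoef.
by move=> x; rewrite normcM normc_expi mulr1.
Qed.

Lemma fcoef_expi n (k xi : int) :
  fcoef n k (fun x : R => expi (x * (- xi)%:~R)) =
  if k == xi then ('i * ((- xi)%:~R)%:C) ^+ n * (pi *+ 2)%:C else 0.
Proof.
rewrite /fcoef.
have -> : (fun x : R => cderive n (fun y : R => expi (y * (- xi)%:~R)) x * expi (x * k%:~R)) =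
  (fun x : R => ('i * ((- xi)%:~R)%:C) ^+ n * expi (x * (k - xi)%:~R)).
  apply/funext => x; rewrite cderive_expi -mulrA -expiD; congr (_ * expi _).
  by rewrite -mulrDr -intrD addrC.
by rewrite cint_expi subr_eq0.
Qed.

Definition csum (z : nat -> C) : C :=
  lim (series (fun n => complex.Re (z n)) @ \oo) +i* 
  lim (series (fun n => complex.Im (z n)) @ \oo).

Lemma inv2_sum n : series (fun n => (n.+1%:R ^+ 2)^-1 : R) n <= 2 - 2 * n.+1%:R^-1.
Proof.
elim: n => [|n IH]; first by rewrite /series /= big_geq // invr1 mulr1 subrr.
rewrite seriesSr; apply: (le_trans (lerD IH (lexx _))).
have n0 : 0 <= n%:R :> R by [].
rewrite -(natr1 n.+1) -(natr1 n); move: (n%:R : R) n0 => x x0.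
rewrite -subr_ge0 (_ : _ - _ = x / ((x + 1) ^+ 2 * (x + 1 + 1))).
  by apply: divr_ge0 => //; rewrite mulr_ge0 ?sqr_ge0 //; lra.
by field; apply/andP; split; apply: lt0r_neq0; lra.
Qed.

Lemma series_dom (a : nat -> R) (K : R) :
  (forall n, `|a n| <= K / n.+1%:R ^+ 2) ->
  cvgn (series a) /\ `|lim (series a @ \oo)| <= 2 * K.
Proof.
move=> aK.
have K0 : 0 <= K.
  by have := aK 0%N; rewrite expr1n divr1; apply: le_trans.
have bS n : series (fun n => `|a n|) n <= 2 * K.
  apply: (@le_trans _ _ (K * series (fun n => (n.+1%:R ^+ 2)^-1 : R) n)).
    rewrite /series /= mulr_sumr; apply: ler_sum => i _; exact: aK.
  rewrite mulrC ler_wpM2r //; apply: (le_trans (inv2_sum n)).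
  by rewrite gerBl mulr_ge0 // invr_ge0.
have cn : cvgn (series (fun n => `|a n|)).
  apply: nondecreasing_is_cvgn.
    by apply/nondecreasing_seqP => n; rewrite seriesSr lerDl.
  by exists (2 * K) => _ [n _ <-]; exact: bS.
have cn' : cvgn [normed series a] by exact: cn.
split; first exact: normed_cvg cn'.
apply: (le_trans (lim_series_norm cn')).
by apply: limr_le => //; apply: nearW.
Qed.

Section csum.
Variables (z : nat -> C) (K : R).
Hypothesis zK : forall n, normc (z n) <= K / n.+1%:R ^+ 2.

Lemma csum_cvg : cvgn (series (fun n => complex.Re (z n))) /\
  cvgn (series (fun n => complex.Im (z n))).
Proof.
split.
- apply: (proj1 (@series_dom _ K _)) => n; exact: le_trans (Re_le_normc _) (zK n).
- apply: (proj1 (@series_dom _ K _)) => n; exact: le_trans (Im_le_normc _) (zK n).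
Qed.

Lemma csum_bound : normc (csum z) <= 4 * K.
Proof.
apply: (le_trans (normc_le _)) => /=.
rewrite (_ : 4 * K = 2 * K + 2 * K); last by ring.
apply: lerD; apply: (proj2 (@series_dom _ K _)) => n.
- exact: le_trans (Re_le_normc _) (zK n).
- exact: le_trans (Im_le_normc _) (zK n).
Qed.
End csum.

Lemma lim_series_lin (a b : R) (f g h : nat -> R) :
  cvgn (series f) -> cvgn (series g) -> cvgn (series h) ->
  lim (series (fun n => a * f n + b * g n + h n) @ \oo) =
  a * lim (series f @ \oo) + b * lim (series g @ \oo) + lim (series h @ \oo).
Proof.
move=> cf cg ch; apply: cvg_lim => //.
rewrite (_ : series _ = fun n => a * series f n + b * series g n + series h n).
  by apply: cvgD => //; apply: cvgD; apply: cvgM => //; exact: cvg_cst.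
by apply/funext => n; rewrite /series /= !big_split /= -!mulr_sumr.
Qed.

Lemma csum_lin a z1 z2 K1 K2 :
  (forall n, normc (z1 n) <= K1 / n.+1%:R ^+ 2) ->
  (forall n, normc (z2 n) <= K2 / n.+1%:R ^+ 2) ->
  csum (fun n => a * z1 n + z2 n) = a * csum z1 + csum z2.
Proof.
move=> /csum_cvg[r1 i1] /csum_cvg[r2 i2]; rewrite /csum.
have -> : (fun n => complex.Re (a * z1 n + z2 n)) =
  (fun n => complex.Re a * complex.Re (z1 n) + (- complex.Im a) * complex.Im (z1 n) + complex.Re (z2 n)).
  by apply/funext => y; case: a (z1 y) (z2 y) => [? ?] [? ?] [? ?] /=; ring.
have -> : (fun n => complex.Im (a * z1 n + z2 n)) =
  (fun n => complex.Im a * complex.Re (z1 n) + complex.Re a * complex.Im (z1 n) + complex.Im (z2 n)).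
  by apply/funext => y; case: a (z1 y) (z2 y) => [? ?] [? ?] [? ?] /=; ring.
rewrite (lim_series_lin _ _ r1 i1 r2) (lim_series_lin _ _ r1 i1 i2).
by case: a => a1 a2; apply/eqP; rewrite eq_complex /=; apply/andP; split; apply/eqP; ring.
Qed.

Lemma lim_series_delta (w : R) (n0 : nat) :
  lim (series (fun n => if n == n0 then w else 0) @ \oo) = w.
Proof.
apply: cvg_lim => //; apply: cvg_near_cst; exists n0.+1 => // n /= n0n.
rewrite /series /= -big_mkcond /= big_mkord (big_pred1 (Ordinal n0n)) //.
Qed.

Lemma csum_delta (w : C) (n0 : nat) :
  csum (fun n => if n == n0 then w else 0) = w.
Proof.
rewrite /csum; case: w => a b.
rewrite -[in RHS](lim_series_delta a n0) -[in RHS](lim_series_delta b n0).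
by congr (lim (series _ @ \oo) +i* lim (series _ @ \oo)); apply/funext => n; case: eqP.
Qed.

Lemma fourierE u (xi : int) :
  fourier u xi = u (fun x : R => expi (x * (- xi)%:~R)).
Proof. by rewrite /fourier; congr (pairing u _); apply/funext => x; rewrite mulrNz mulrN. Qed.

Lemma normc_exp (z : C) n : normc (z ^+ n) = normc z ^+ n.
Proof. by elim: n => [|n IH]; rewrite ?expr0 ?normc1 // !exprS normcM IH. Qed.

Lemma normc_iR (x : R) : normc ('i * x%:C) = `|x|.
Proof. by rewrite normcM /= !expr0n /= add0r expr1n sqrtr1 mul1r addr0 sqrtr_sqr. Qed.

Lemma normc_realC (x : R) : normc x%:C = `|x|.
Proof. by rewrite /= expr0n /= addr0 sqrtr_sqr. Qed.

Lemma fourier_growth u : exists (B : R) (N : nat), 0 <= B /\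
  forall xi : int, normc (fourier u xi) <= B * (1 + `|xi%:~R|) ^+ N.
Proof.
have [B [N H]] := pairing_continuous u.
exists `|B|, N; split=> // xi; rewrite fourierE.
apply: le_trans (_ : B * (1 + `|xi%:~R|) ^+ N <= _); last first.
  by rewrite ler_wpM2r ?exprn_ge0 ?addr_ge0 // ler_norm.
apply: H; first exact: test_expi.
move=> k x kN; rewrite cderive_expi normcM normc_expi mulr1 normc_exp normc_iR.
rewrite mulrNz normrN; apply: (@le_trans _ _ ((1 + `|xi%:~R|) ^+ k)).
  by apply: lerXn2r; rewrite ?nnegrE ?addr_ge0 // lerDr.
by rewrite ler_weXn2l // lerDl.
Qed.

Lemma pi2_gt0 : 0 < pi *+ 2 :> R.
Proof. by rewrite pmulrn_lgt0 // pi_gt0. Qed.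

Lemma normc_ge0 (z : C) : 0 <= normc z.
Proof. by case: z => a b /=; rewrite sqrtr_ge0. Qed.

Lemma derive1n_periodic (f : R -> R) (T : R) n :
  periodic f T -> periodic (derive1n n f) T.
Proof.
move=> pf; elim: n => [//|n IH] x; rewrite derive1nS !derive1E /derive.
set F := fun h => _; set G := fun h => _.
suff -> : F = G by [].
by apply/funext => h; rewrite /F /G /= IH addrA IH.
Qed.

Lemma periodicz (f : R -> R) (T : R) : periodic f T ->
  forall (k : int) x, f (x + T * k%:~R) = f x.
Proof.
move=> pf [n|n] x; first by rewrite -pmulrn mulr_natr periodicn.
rewrite NegzE mulrNz mulrN -pmulrn mulr_natr -[LHS](periodicn pf n.+1).
by rewrite subrK.
Qed.

Lemma periodic_bounded (f : R -> R) (T : R) : 0 < T -> continuous f ->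
  periodic f T -> exists M, forall x, `|f x| <= M.
Proof.
move=> T0 cf pf.
have ca : {within `[0, T], continuous (fun x => `|f x|)}.
  apply: continuous_subspaceT => x; apply: continuous_comp; [exact: cf|exact: norm_continuous].
have [c _ cM] := EVT_max (ltW T0) ca.
exists `|f c| => x; rewrite -(periodicz pf (- Num.floor (x / T)) x); apply: cM.
have /andP[h1 h2] := floor_itv (x / T).
rewrite in_itv /= mulrNz mulrN subr_ge0 lerBlDr [T * _]mulrC.
rewrite -ler_pdivlMr // h1 /=.
have -> : T + (Num.floor (x / T))%:~R * T = (Num.floor (x / T) + 1)%:~R * T.
  by rewrite intrD mulrDl mul1r addrC.
by rewrite -ler_pdivrMr // ltW.
Qed.

Lemma test_bounded (phi : R -> C) (K : nat) : test_function phi ->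
  exists M, forall j x, (j <= K)%N -> normc (cderive j phi x) <= M.
Proof.
move=> tphi; have [pphi _ _] := tphi.
have B j : exists M, forall x, normc (cderive j phi x) <= M.
  have [cr ci] := cderive_continuous j tphi.
  have [|Mr Hr] := periodic_bounded pi2_gt0 cr.
    by apply: derive1n_periodic => x; rewrite pphi.
  have [|Mi Hi] := periodic_bounded pi2_gt0 ci.
    by apply: derive1n_periodic => x; rewrite pphi.
  exists (Mr + Mi) => x; apply: (le_trans (normc_le _)); exact: lerD.
elim: K => [|K [M HM]].
  by have [M HM] := B 0%N; exists M => j x; rewrite leqn0 => /eqP->.
have [M' HM'] := B K.+1; exists (Num.max M M') => j x.
rewrite leq_eqVlt ltnS le_max => /orP[/eqP->|jK]; first by rewrite HM' orbT.
by rewrite HM.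
Qed.

Lemma bound_split (b0 b r q p M : R) : p != 0 -> q != 0 ->
  2 * b0 * b * r * M / q ^+ 2 = (b0 * b * (r / q ^+ 2) / p) * (2 * M * p).
Proof. by move=> p0 q0; field; rewrite p0 q0. Qed.

Section multiplier.
Variables (m : int -> C) (B0 : R) (u : tdistribution R) (B : R) (N : nat).
Hypothesis m_bounded : forall k, normc (m k) <= B0.
Hypothesis B_ge0 : 0 <= B.
Hypothesis u_growth :
  forall xi : int, normc (fourier u xi) <= B * (1 + `|xi%:~R|) ^+ N.

Let ord (k : int) : nat := if k == 0 then 0%N else N.+2.

Definition mult_mode (k : int) (phi : R -> C) : C :=
  m k * fourier u k * (((pi *+ 2)%:C)^-1 * (('i * ((- k)%:~R)%:C) ^+ ord k)^-1) *
  fcoef (ord k) k phi.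

Local Lemma mult_mode_lin k a phi psi : test_function phi -> test_function psi ->
  mult_mode k (fun x => a * phi x + psi x) = a * mult_mode k phi + mult_mode k psi.
Proof. by move=> t1 t2; rewrite /mult_mode fcoef_lin // mulrDr mulrCA. Qed.

Let D : R := 2 * B0 * B * 2 ^+ N.+2.

Local Lemma B0_ge0 : 0 <= B0.
Proof. by apply: le_trans (m_bounded 0); case: (m 0) => a b /=; rewrite sqrtr_ge0. Qed.

Local Lemma D_ge0 : 0 <= D.
Proof. by rewrite /D mulr_ge0 ?exprn_ge0 // mulr_ge0 // mulr_ge0 // B0_ge0. Qed.

Local Lemma weight_bound (k : int) :
  (1 + `|k%:~R|) ^+ N * (`|k%:~R| ^+ ord k)^-1 <=
  2 ^+ N.+2 / (1 + `|k%:~R|) ^+ 2 :> R.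
Proof.
rewrite /ord; have [->|k0] := eqVneq k 0.
  by rewrite mulr0z normr0 addr0 !expr1n expr0 invr1 !mulr1 exprn_ege1 // ler1n.
have k1 : 1 <= `|k%:~R| :> R.
  by rewrite -intr_norm -[1]/(1%:~R) ler_int -gtz0_ge1 normr_gt0.
have kp : 0 < `|k%:~R| :> R by exact: lt_le_trans k1.
have k2 : 0 < 1 + `|k%:~R| :> R by rewrite addr_gt0.
rewrite ler_pdivrMr ?exprn_gt0 // mulrAC ler_pdivlMr ?exprn_gt0 //.
rewrite -exprD addn2 -exprMn; apply: lerXn2r.
- by rewrite nnegrE ltW.
- by rewrite nnegrE ltW // mulr_gt0.
- by move: k1; set y := `|_|; move=> k1; lra.
Qed.

Local Lemma mult_mode_bound k phi M : test_function phi ->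
  (forall j x, (j <= N.+2)%N -> normc (cderive j phi x) <= M) ->
  normc (mult_mode k phi) <= D * M / (1 + `|k%:~R|) ^+ 2.
Proof.
move=> tphi H.
have M0 : 0 <= M by apply: le_trans (H 0%N 0 _) => //; exact: normc_ge0.
have jord : (ord k <= N.+2)%N by rewrite /ord; case: eqP.
have := @fcoef_bound (ord k) k phi M tphi (fun x => H _ x jord).
rewrite /mult_mode !normcM !normcV normc_exp normc_iR normc_realC mulrNz normrN.
rewrite (gtr0_norm pi2_gt0) => F.
have p0 := pi2_gt0.
have -> : D * M / (1 + `|k%:~R|) ^+ 2 =
  (B0 * B * (2 ^+ N.+2 / (1 + `|k%:~R|) ^+ 2) / (pi *+ 2)) * (2 * M * (pi *+ 2)).
  by apply: bound_split; apply: lt0r_neq0 => //; rewrite ltr_pwDl.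
apply: ler_pM => //; try exact: normc_ge0.
  apply: mulr_ge0; first by apply: mulr_ge0; exact: normc_ge0.
  by apply: mulr_ge0; rewrite invr_ge0 ?exprn_ge0 // ltW.
rewrite mulrCA mulrC ler_pM2r ?invr_gt0 //.
apply: le_trans (_ : B0 * (B * (1 + `|k%:~R|) ^+ N) * (`|k%:~R| ^+ ord k)^-1 <= _).
  rewrite ler_wpM2r ?invr_ge0 ?exprn_ge0 //.
  by apply: ler_pM; rewrite ?normc_ge0.
rewrite [B0 * (B * _)]mulrA -[leLHS]mulrA; apply: ler_wpM2l.
  by rewrite mulr_ge0 ?B0_ge0.
exact: weight_bound.
Qed.

Definition mult_seq phi (n : nat) : C :=
  mult_mode (Posz n) phi + mult_mode (Negz n) phi.

Local Lemma mult_seq_bound phi M : test_function phi ->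
  (forall j x, (j <= N.+2)%N -> normc (cderive j phi x) <= M) ->
  forall n, normc (mult_seq phi n) <= (2 * (D * M)) / n.+1%:R ^+ 2.
Proof.
move=> tphi H n.
have M0 : 0 <= M by apply: le_trans (H 0%N 0 _) => //; exact: normc_ge0.
apply: (le_trans (le_normcD _ _)).
rewrite -mulrA mulr_natl mulr2n; apply: lerD.
  apply: (le_trans (mult_mode_bound _ tphi H)).
  by rewrite -pmulrn ger0_norm // addrC natr1.
apply: (le_trans (mult_mode_bound _ tphi H)).
rewrite NegzE mulrNz normrN -pmulrn ger0_norm //.
apply: ler_wpM2l; first by rewrite mulr_ge0 // D_ge0.
rewrite lef_pV2 ?posrE ?exprn_gt0 ?ltr_pwDl //.
by apply: lerXn2r; rewrite ?nnegrE ?addr_ge0 // lerDr.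
Qed.

Lemma multiplier_exists :
  exists w : tdistribution R, forall k, fourier w k = m k * fourier u k.
Proof.
pose W phi := csum (mult_seq phi).
have Wlin a phi psi : test_function phi -> test_function psi ->
    W (fun x => a * phi x + psi x) = a * W phi + W psi.
  move=> t1 t2; rewrite /W.
  have [M1 H1] := test_bounded N.+2 t1.
  have [M2 H2] := test_bounded N.+2 t2.
  rewrite -(csum_lin a (mult_seq_bound t1 H1) (mult_seq_bound t2 H2)).
  congr (csum _); apply/funext => n; rewrite /mult_seq.
  rewrite (mult_mode_lin _ a t1 t2) (mult_mode_lin _ a t1 t2).
  by rewrite mulrDr addrACA.
have Wc : exists (B1 : R) (N1 : nat), forall phi (M : R),
    test_function phi ->
    (forall k x, (k <= N1)%N -> normc (cderive k phi x) <= M) ->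
    normc (W phi) <= B1 * M.
  exists (4 * (2 * D)), N.+2 => phi M tphi H.
  have := csum_bound (mult_seq_bound tphi H).
  by rewrite !mulrA.
exists (TDistribution Wlin Wc) => xi; rewrite fourierE /= /W.
set e := fun x : R => _.
have modeE k : mult_mode k e = if k == xi then m xi * fourier u xi else 0.
  rewrite /mult_mode /e fcoef_expi; case: eqP => [->|_]; last by rewrite mulr0.
  rewrite -mulrA; rewrite -[RHS]mulr1; congr (_ * _).
  set p := 'i * _; have p0 : p ^+ ord xi != 0.
    rewrite /ord; have [_|k0] := eqVneq xi 0; first by rewrite expr0 oner_neq0.
    rewrite expf_neq0 // /p; apply/eqP => H.
    have := congr1 (@normc R) H; rewrite normc_iR normc0 => /eqP.
    by rewrite normr_eq0 intr_eq0 oppr_eq0 (negPf k0).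
  have q0 : (pi *+ 2)%:C != 0 :> C.
    by rewrite eq_complex /= eqxx andbT lt0r_neq0 // pi2_gt0.
  by rewrite -mulrA (mulKf p0) (mulVf q0).
rewrite /mult_seq; case: xi @e modeE => n0 e modeE.
  rewrite -[RHS](csum_delta _ n0); congr csum; apply/funext => n.
  by rewrite !modeE /= addr0.
rewrite -[RHS](csum_delta _ n0); congr csum; apply/funext => n.
by rewrite !modeE /= add0r.
Qed.
End multiplier.

Lemma normc_phase_factor (u0 : tdistribution R) t k :
  normc (phase_factor u0 t k) <= 1.
Proof. by rewrite /phase_factor; case: eqP => _; rewrite ?normc1 ?normc_expi. Qed.

Lemma phase_shift_exists (u0 : tdistribution R) (t : R) (u : tdistribution R) :
  exists w : tdistribution R,
    forall xi, fourier w xi = phase_factor u0 t xi * fourier u xi.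
Proof.
have [B [N [B0 H]]] := fourier_growth u.
exact: (multiplier_exists (normc_phase_factor u0 t) B0 H).
Qed.

(* Characterised by phase_shiftE below; the choice is harmless since only
   Fourier coefficients enter Sobolev norms. *)
Definition phase_shift (u0 : tdistribution R) (v : R -> tdistribution R) (t : R) :
  tdistribution R := sval (cid (phase_shift_exists u0 t (v t))).

Lemma phase_shiftE u0 v t xi :
  fourier (phase_shift u0 v t) xi = phase_factor u0 t xi * fourier (v t) xi.
Proof. by rewrite /phase_shift; case: cid. Qed.

End Multipliers.

(* Main.v *)
Require Import Defs.
From HB Require Import structures.
From mathcomp Require Import all_boot all_order all_algebra.
From mathcomp Require Import complex.
From mathcomp Require Import all_classical all_reals all_analysis.
From mathcomp Require Import ring lra.

Set Implicit Arguments.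
Unset Strict Implicit.
Unset Printing Implicit Defensive.

Import Order.TTheory GRing.Theory Num.Theory.
Import numFieldNormedType.Exports.

Local Open Scope classical_set_scope.
Local Open Scope ring_scope.

(* Mode by mode, |e^{i theta} - 1| <= |theta| bounds the phase difference by
   2 |t| |hat u0 (xi)|^2 / |xi|.  The factor 1 / |xi| absorbs one power of
   <xi>, since <xi> <= 2 |xi| for xi <> 0, and the factor <xi>^{-2s} turns
   |hat u0 (xi)|^2 into the square of a single term of the l^2 norm of u0 in
   H^{-s}, hence is at most ||u0||^2. *)

(** Oddness reduces to x >= 0, where the mean value theorem on [0, x] and |cos| <= 1 conclude. *)
Lemma norm_sin_le (R : realType) (x : R) : `|sin x| <= `|x|.
Proof.
wlog x0 : x / 0 <= x => [H|].
  have [/H//|/ltW x0] := leP 0 x.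
  by rewrite -(normrN x) -(normrN (sin x)) -sinN; apply: H; rewrite oppr_ge0.
have [c _] := @MVT_segment R sin cos 0 x x0 (fun y _ => is_derive_sin y)
  (continuous_subspaceT (@continuous_sin R)).
rewrite sin0 !subr0 => ->.
by rewrite normrM ler_piMl // cos_max.
Qed.

(** The chord formula |e^{i theta} - 1| = 2 |sin (theta / 2)| reduces this to [norm_sin_le] at the
    half angle. *)
Lemma normc_expiB1_le (R : realType) (theta : R) :
  Normc.normc (expi theta - 1) <= `|theta|.
Proof.
rewrite /= -(sqrtr_sqr theta) ler_wsqrtr // subr0.
have -> : (cos theta - 1) ^+ 2 + sin theta ^+ 2 = (2 * sin (theta / 2)) ^+ 2.
  have -> : theta = theta / 2 + theta / 2 by field.
  rewrite cosD sinD.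
  have -> : (theta / 2 + theta / 2) / 2 = theta / 2 by field.
  have E := cos2sin2 (theta / 2).
  set c := cos _ in E *; set d := sin _ in E *.
  (* After this regrouping the cosine occurs only through its square, which [E] replaces by 1 -
     d^2. *)
  have -> : (c * c - d * d - 1) ^+ 2 + (d * c + c * d) ^+ 2 =
    (c ^+ 2 - d ^+ 2 - 1) ^+ 2 + 4 * c ^+ 2 * d ^+ 2 by ring.
  by rewrite E; ring.
have -> : theta ^+ 2 = (2 * (theta / 2)) ^+ 2 by field.
rewrite [leLHS]exprMn [leRHS]exprMn ler_pM2l //.
by rewrite -(real_normK (num_real (sin _))) -(real_normK (num_real (theta / 2))) lerXn2r // norm_sin_le.
Qed.

(** Multiplying by [bracket xi] instead of dividing by |xi| covers xi = 0 as well, where the phase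
    factor is 1 and the left side vanishes. *)
Lemma phase_factorB1_le (R : realType) (u0 : tdistribution R) (t : R) (xi : int) :
  bracket xi * Normc.normc (phase_factor u0 t xi - 1) <=
  4 * `|t| * Normc.normc (fourier u0 xi) ^+ 2.
Proof.
set U := Normc.normc (fourier _ _).
rewrite /phase_factor; case: ifPn => [_|xi0].
  by rewrite subrr Normc.normc0 mulr0 mulr_ge0 ?sqr_ge0 // mulr_ge0.
have xi1 : 1 <= `|xi%:~R| :> R.
  by rewrite -intr_norm -[1]/(1%:~R) ler_int -gtz0_ge1 normr_gt0.
have xip : 0 < `|xi%:~R| :> R by exact: lt_le_trans xi1.
(* The first 2 comes from <xi> <= 2 |xi|, true since |xi| >= 1, the second from the phase; their
   product is the constant 4. *)
apply: (@le_trans _ _ (2 * `|xi%:~R| * (2 * (U ^+ 2 / `|xi%:~R|) * `|t|))).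
  apply: ler_pM; rewrite ?normc_ge0 //.
  - by rewrite /bracket addr_ge0.
  - by rewrite /bracket; lra.
  - apply: (le_trans (normc_expiB1_le _)).
    by rewrite normrM (normrM (- 2)) (normrM (U ^+ 2)) normrN normfV normr_nat (ger0_norm (sqr_ge0 U)).
rewrite le_eqVlt; apply/orP; left; apply/eqP; field; exact: lt0r_neq0.
Qed.

Lemma le_sobolev_norm (R : realType) (sigma tau c : R) (w u : tdistribution R) :
  0 <= c ->
  (forall xi, bracket xi `^ sigma * Normc.normc (fourier w xi) <=
              c * (bracket xi `^ tau * Normc.normc (fourier u xi))) ->
  (sobolev_norm sigma w <= c%:E * sobolev_norm tau u)%E.
Proof.
move=> c0 H; rewrite /sobolev_norm.
set S := (\esum_(xi in _) _)%E; set S' := (\esum_(xi in _) _)%E.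
have S0 : (0 <= S)%E by apply: esum_ge0 => xi _; rewrite lee_fin sqr_ge0.
have S'0 : (0 <= S')%E by apply: esum_ge0 => xi _; rewrite lee_fin sqr_ge0.
(* Written as the square root of its square, [c] can be moved under the root, and monotonicity of
   the root leaves only the sums of squares to compare. *)
have -> : c%:E = ((c ^+ 2)%:E `^ 2^-1)%E.
  by rewrite poweR_EFin powR12_sqrt ?sqr_ge0 // sqrtr_sqr ger0_norm.
rewrite -poweRM ?lee_fin ?sqr_ge0 //.
have c2S : (0 <= (c ^+ 2)%:E * S')%E by rewrite mule_ge0 // lee_fin sqr_ge0.
apply: gt0_ler_poweR; rewrite ?invr_ge0 ?in_itv /= ?leey ?andbT //.
(* An [\esum] is the supremum of its finite subsums, so it suffices to bound the sum over each
   finite [X]. *)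
apply: ge_ereal_sup => _ /= [X [finX _]] <-.
apply: (@le_trans _ _ (\sum_(xi \in X) ((c ^+ 2)%:E *
   ((bracket xi `^ tau * Normc.normc (fourier u xi)) ^+ 2)%:E))%E).
  apply: lee_fsum => // xi _; rewrite -EFinM lee_fin -exprMn.
  by rewrite lerXn2r ?nnegrE ?mulr_ge0 ?powR_ge0 ?normc_ge0.
rewrite -ge0_mule_fsumr; last by move=> xi; rewrite lee_fin sqr_ge0.
by rewrite lee_wpmul2l ?lee_fin ?sqr_ge0 // esum_ge //; exists X.
Qed.

(** The sup norm is at most the l^2 norm: the singleton of [xi] is one of the finite sets in the
    supremum that defines the sum of squares. *)
Lemma le_term_sobolev_norm (R : realType) (sigma : R) (u : tdistribution R) (xi : int) :
  ((bracket xi `^ sigma * Normc.normc (fourier u xi))%:E <= sobolev_norm sigma u)%E.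
Proof.
set a := _ * _.
have a0 : 0 <= a by rewrite mulr_ge0 ?powR_ge0 ?normc_ge0.
have -> : a%:E = ((a ^+ 2)%:E `^ 2^-1)%E.
  by rewrite poweR_EFin powR12_sqrt ?sqr_ge0 // sqrtr_sqr ger0_norm.
have aS : ((a ^+ 2)%:E <= \esum_(xi in [set: int])
    ((bracket xi `^ sigma * Normc.normc (fourier u xi)) ^+ 2)%:E)%E.
  by apply: esum_ge; exists [set xi]; [split | rewrite fsbig_set1].
have a20 : (0 <= (a ^+ 2)%:E)%E by rewrite lee_fin sqr_ge0.
apply: gt0_ler_poweR; rewrite ?invr_ge0 ?in_itv /= ?leey ?andbT //.
exact: le_trans aS.
Qed.

Theorem mainTheorem3 (R : realType) :
  exists2 K : R, 0 < K &
  forall (s : R) (u0 : tdistribution R),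
    0 <= s -> s < 1 / 2 -> in_sobolev (- s) u0 -> fourier u0 0 = 0 ->
  forall (v : R -> tdistribution R) (t alpha : R), in_sobolev alpha (v t) ->
    (sobolev_norm (alpha + 1 - 2 * s) (tdist_sub (phase_shift u0 v t) (v t))
     <= (K * `|t|)%:E * sobolev_norm (- s) u0 ^+ 2 * sobolev_norm alpha (v t))%E.
Proof.
exists 4 => // s u0 _ _ u0s _ v t alpha _.
set N := sobolev_norm (- s) u0.
have N0 : (0 <= N)%E by exact: poweR_ge0.
(* Membership of [u0] in H^{-s} makes [N] a real number, so that the whole constant can serve as the
   real [c] of [le_sobolev_norm]. *)
have Nfin : N = (fine N)%:E by rewrite fineK // ge0_fin_numE.
have A0 : 0 <= fine N by exact: fine_ge0.
rewrite Nfin -EFin_expe -EFinM.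
apply: le_sobolev_norm => [|xi]; first by rewrite mulr_ge0 ?sqr_ge0 // mulr_ge0.
have -> : fourier (tdist_sub (phase_shift u0 v t) (v t)) xi =
    (phase_factor u0 t xi - 1) * fourier (v t) xi.
  by rewrite mulrBl mul1r -phase_shiftE.
have bp : 0 < bracket xi :> R by rewrite ltr_pwDl.
have b0 : bracket xi != 0 :> R by exact: lt0r_neq0.
(* The weight splits into <xi>^alpha for [v t], one power of <xi> to absorb 1 / |xi|, and one
   <xi>^{-s} for each of the two factors |hat u0 (xi)|. *)
have -> : alpha + 1 - 2 * s = alpha + 1 + - s + - s by ring.
rewrite !powRD ?b0 ?implybT // powRr1 ?(ltW bp) // Normc.normcM.
set q := bracket xi `^ (- s).
have := phase_factorB1_le u0 t xi.
have : q * Normc.normc (fourier u0 xi) <= fine N.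
  by rewrite -lee_fin -Nfin; exact: le_term_sobolev_norm.
have q0 : 0 <= q by exact: powR_ge0.
set U := Normc.normc (fourier u0 xi); set P := Normc.normc (phase_factor _ _ _ - 1).
have U0 : 0 <= U by exact: normc_ge0.
move=> qU bP.
(* Cancelling <xi>^alpha and the coefficient of [v t] leaves an inequality in [u0] and [t] alone. *)
rewrite [leRHS]mulrCA -!mulrA ler_wpM2l ?powR_ge0 // !mulrA.
rewrite ler_wpM2r ?normc_ge0 //.
apply: (@le_trans _ _ (4 * `|t| * U ^+ 2 * q ^+ 2)).
  have -> : bracket xi * q * q * P = bracket xi * P * q ^+ 2 by ring.
  by rewrite ler_wpM2r ?sqr_ge0.
have -> : 4 * `|t| * U ^+ 2 * q ^+ 2 = 4 * `|t| * (q * U) ^+ 2 by ring.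
rewrite -(mulrA (4 * `|t|)) -expr2 ler_wpM2l ?mulr_ge0 //.
by rewrite lerXn2r ?nnegrE ?mulr_ge0.
Qed.
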